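(* Let $n\ge1$ be an integer, let $\delta\ge0$, and let $X$ be a metric space. If $X$ is $(n,\delta)$-hyperbolic, then the injective hull $E(X)$ contains no isometric copy of $\{\pm se_i:i=1,\ldots,n+1\}\subset l_\infty^{\,n+1}$ for $s>\delta$. Conversely, if $E(X)$ contains no isometric copy of $\{\pm se_i:i=1,\ldots,n+1\}\subset l_\infty^{\,n+1}$ for $s>\delta$, then $X$ is $(n,n\delta)$-hyperbolic.
   Context: $l_\infty^{\,m}:=(\mathbb{R}^m,\|\cdot\|_\infty)$, and $e_1,\ldots,e_m$ are the canonical basis vectors of $\mathbb{R}^m$. An isometric copy of $A$ in $Y$ is the image of a distance-preserving map $A\to Y$. Let $I_n=\{\pm1,\ldots,\pm(n+1)\}$. For $\delta\ge0$, a metric space $(X,d)$ is $(n,\delta)$-hyperbolic if for every family $(x_i)_{i\in I_n}$ of points of $X$ there is a permutation $\alpha\ne-\mathrm{id}$ of $I_n$ with $\sum_{i\in I_n}d(x_i,x_{-i})\le\sum_{i\in I_n}d(x_i,x_{\alpha(i)})+2\delta$. The injective hull $E(X)$ of a metric space $(X,d)$ is the set of all functions $f:X\to\mathbb{R}$ that are minimal, in the pointwise order, among the functions satisfying $f(x)+f(y)\ge d(x,y)$ for all $x,y\in X$; it is endowed with the (finite) metric $\|f-g\|_\infty=\sup_X|f-g|$, and $x\mapsto d(\cdot,x)$ is the canonical isometric embedding $X\to E(X)$. *)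

(* Defs.v *)
From HB Require Import structures.
From mathcomp Require Import all_boot all_order all_algebra all_fingroup.
From mathcomp Require Import all_classical all_reals all_analysis.
From mathcomp Require Import lra.
Import Order.TTheory GRing.Theory Num.Theory.
Import numFieldNormedType.Exports.

Set Implicit Arguments.
Unset Strict Implicit.
Unset Printing Implicit Defensive.

Local Open Scope classical_set_scope.
Local Open Scope ring_scope.

(* The index set I_n = {±1, ..., ±(n+1)}: (k, false) stands for k + 1 and
   (k, true) for -(k + 1), where k ranges over 0, ..., n. *)
Definition signed_index (n : nat) : finType := ('I_n.+1 * bool)%type.

Definition index_opp (n : nat) (i : signed_index n) : signed_index n :=
  (i.1, ~~ i.2).

Lemma index_oppK (n : nat) : involutive (@index_opp n).
Proof. by case=> k b; rewrite /index_opp /= negbK. Qed.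

Definition index_opp_perm (n : nat) : {perm signed_index n} :=
  perm (inv_inj (@index_oppK n)).

Definition hyperbolic (R : realType) (X : metricType R) (n : nat) (delta : R)
    : Prop :=
  forall x : signed_index n -> X,
    exists2 alpha : {perm signed_index n}, alpha <> index_opp_perm n &
      \sum_(i : signed_index n) mdist (x i) (x (index_opp i)) <=
      \sum_(i : signed_index n) mdist (x i) (x (alpha i)) + 2 * delta.

Definition hull_admissible (R : realType) (X : metricType R) : set (X -> R) :=
  [set f | forall x y : X, mdist x y <= f x + f y].

Definition hull_set (R : realType) (X : metricType R) : set (X -> R) :=
  [set f | hull_admissible f /\
    forall g : X -> R, hull_admissible g -> (forall x, g x <= f x) -> g = f].

Definition injective_hull (R : realType) (X : metricType R) : Type :=
  set_type (@hull_set R X).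

Section InjectiveHullMetric.
Context (R : realType) (X : metricType R).
Implicit Types f g h : injective_hull X.

HB.instance Definition _ := Choice.copy (injective_hull X) (set_type (@hull_set R X)).

Definition hull_fun f : X -> R := \val f.

Definition hull_dist f g : R :=
  sup [set `|hull_fun f x - hull_fun g x| | x in [set: X]].

Lemma hull_funP f : hull_set (hull_fun f).
Proof. exact: set_valP. Qed.

Lemma hull_fun_ge0 f x : 0 <= hull_fun f x.
Proof.
have [/(_ x x) + _] := hull_funP f.
by rewrite mdistxx -mulr2n pmulrn_lge0.
Qed.

Lemma hull_fun_lipschitz f x y : hull_fun f x <= mdist x y + hull_fun f y.
Proof.
have [fadm fmin] := hull_funP f.
pose m := Num.min (hull_fun f x) (mdist x y + hull_fun f y).
have m0 : 0 <= m.
  by rewrite le_min hull_fun_ge0 addr_ge0 ?mdist_ge0 ?hull_fun_ge0.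
have mz z : mdist x z <= m + hull_fun f z.
  rewrite addr_minl le_min fadm /= -addrA.
  by rewrite (le_trans (metric_triangle x y z))// lerD2l.
pose g z := if z == x then m else hull_fun f z.
have gf : g = hull_fun f.
  apply: fmin => [a b|z]; rewrite /g.
    case: eqP => [->|_]; case: eqP => [->|_] //.
      by rewrite mdistxx addr_ge0.
    by rewrite metric_sym addrC.
  by case: eqP => [->|_] //; rewrite ge_min lexx.
by rewrite -{1}gf /g eqxx ge_min lexx orbT.
Qed.

Lemma hull_dist_has_sup f g (z : X) :
  has_sup [set `|hull_fun f x - hull_fun g x| | x in [set: X]].
Proof.
split; first by exists `|hull_fun f z - hull_fun g z|, z.
exists (hull_fun f z + hull_fun g z) => _ [x _ <-].
have H (u v : injective_hull X) :
    hull_fun u x - hull_fun v x <= hull_fun u z + hull_fun v z.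
  have [/(_ x z) xz _] := hull_funP v.
  by have := hull_fun_lipschitz u x z; lra.
by have := H f g; have := H g f; rewrite ler_norml; lra.
Qed.

Lemma hull_dist_ub f g x : `|hull_fun f x - hull_fun g x| <= hull_dist f g.
Proof.
apply: sup_upper_bound; first exact: hull_dist_has_sup x.
by exists x.
Qed.

Lemma hull_dist_empty f g : ~ (exists x : X, True) -> hull_dist f g = 0.
Proof.
move=> X0; rewrite -[RHS](@sup0 R) /hull_dist; congr sup.
by apply/seteqP; split=> [t [x _ _]|//]; case: X0; exists x.
Qed.

Lemma hull_dist_ge0 f g : 0 <= hull_dist f g.
Proof.
have [[z _]|X0] := pselect (exists z : X, True).
  exact: le_trans (normr_ge0 _) (hull_dist_ub f g z).
by rewrite hull_dist_empty.
Qed.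

Lemma hull_dist_le f g (c : R) : 0 <= c ->
  (forall x, `|hull_fun f x - hull_fun g x| <= c) -> hull_dist f g <= c.
Proof.
move=> c0 H; have [[z _]|X0] := pselect (exists z : X, True).
  by apply: ge_sup; [exists `|hull_fun f z - hull_fun g z|, z|
    move=> _ [x _ <-]].
by rewrite hull_dist_empty.
Qed.

Lemma hull_distxx f : hull_dist f f = 0.
Proof.
apply/eqP; rewrite eq_le hull_dist_ge0 andbT.
by apply: hull_dist_le => // x; rewrite subrr normr0.
Qed.

Lemma hull_dist_positivity f g : hull_dist f g = 0 -> f = g.
Proof.
move=> fg; apply: val_inj; apply/funext => x.
apply/eqP; rewrite -subr_eq0 -normr_le0 -fg.
exact: hull_dist_ub.
Qed.

Lemma hull_dist_sym f g : hull_dist f g = hull_dist g f.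
Proof.
by rewrite /hull_dist; congr sup; apply/seteqP; split=> _ [x _ <-];
  exists x => //; rewrite distrC.
Qed.

Lemma hull_dist_triangle g f h :
  hull_dist f h <= hull_dist f g + hull_dist g h.
Proof.
apply: hull_dist_le => [|x]; first by rewrite addr_ge0 ?hull_dist_ge0.
by rewrite (le_trans (ler_distD (hull_fun g x) _ _))// lerD ?hull_dist_ub.
Qed.

HB.instance Definition _ := isMetric.Build R (injective_hull X)
  hull_distxx hull_dist_positivity hull_dist_sym hull_dist_triangle.

Lemma mdist_hullE f g : mdist f g = hull_dist f g.
Proof. by []. Qed.

End InjectiveHullMetric.

Definition isometric_copy (R : realType) (V : normedModType R)
    (Y : metricType R) (A : set V) (C : set Y) : Prop :=
  exists2 phi : A -> Y,
    (forall a b : A, mdist (phi a) (phi b) = `|\val a - \val b|) &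
    C = range phi.

Definition contains_isometric_copy (R : realType) (V : normedModType R)
    (Y : metricType R) (A : set V) : Prop :=
  exists C : set Y, isometric_copy A C.

(* {±s e_i : 1 <= i <= m}. The library norm on row vectors is the sup norm,
   so 'rV[R]_m is l_infty^m. *)
Definition cross_polytope (R : realType) (m : nat) (s : R) : set 'rV[R]_m :=
  [set v | exists i : 'I_m, v = s *: delta_mx 0 i \/ v = - (s *: delta_mx 0 i)].

Arguments cross_polytope {R} m s.

(* Main.v *)
(* Every f in E(X) is tight up to eps, so d(f, g) is the supremum of
   d(y, z) - f(y) - g(z). Hence (n, delta)-hyperbolicity passes from X to E(X)
   up to arbitrarily small errors, and it fails on +-s e_i, where each index
   with alpha(i) <> -i, of which there are at least two, loses s.

   Conversely, let (x_i) violate (n, n delta)-hyperbolicity and set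
   w(i, j) = d(x_i, x_j). It suffices to find s > delta and f on I_n with
   f(i) + f(-i) = w(i, -i) and f(i) + f(j) >= w(i, j) + s for j <> i, -i; the
   triangle inequality then gives f(i) >= s. Indeed, the functions
   k |-> f(k) + v_k, -k |-> f(-k) - v_k with v = +-s e_l are then admissible,
   and a 1-Lipschitz retraction onto the hull sends their extensions to X to a
   copy of the cross polytope. Writing
   f(a) = w(a, -a)/2 + phi(a), the conditions become
   phi(b) - phi(a) <= gain(a, b) - s with
   gain(a, b) = (w(a, -a) + w(b, -b))/2 - w(a, -b), and phi exists if no closed
   walk has negative cost. A simple cycle is a permutation, so its gain exceeds
   2 n delta, which pays for lengths up to 2n. On a longer cycle avoiding the
   edges a -> -a some pairs k, -k and l, -l interleave; as
   gain(-b, -a) = gain(a, b), the cycle together with its mirror image is then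
   a union of four closed walks, so its gain exceeds 4 n delta, which is at
   least (2n + 2) delta. *)

Require Import Defs.
From HB Require Import structures.
From mathcomp Require Import all_boot all_order all_algebra all_fingroup.
From mathcomp Require Import all_classical all_reals all_analysis.
From mathcomp Require Import lra zify.
Import Order.TTheory GRing.Theory Num.Theory.
Import numFieldNormedType.Exports.
Local Open Scope classical_set_scope.
Local Open Scope ring_scope.

(** * Costs of walks and closed walks in a weighted digraph *)

Section Walks.
Context {R : realDomainType} {T : eqType} (e : T -> T -> R).
Implicit Types (x y : T) (p q : seq T).

Fixpoint walk_cost x p : R :=
  if p is y :: q then e x y + walk_cost y q else 0.

Definition cycle_cost p : R :=
  if p is x :: q then walk_cost x (rcons q x) else 0.

Lemma walk_cost_cat x p y q :
  walk_cost x (p ++ y :: q) = walk_cost x (rcons p y) + walk_cost y q.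
Proof.
elim: p x => [|z p IH] x /=; first by rewrite addr0.
by rewrite IH addrA.
Qed.

Lemma walk_cost_rcons x p y :
  walk_cost x (rcons p y) = walk_cost x p + e (last x p) y.
Proof.
elim: p x => [|z p IH] x /=; first by rewrite addr0 add0r.
by rewrite IH addrA.
Qed.

Lemma cycle_cost_catC p q : cycle_cost (p ++ q) = cycle_cost (q ++ p).
Proof.
case: p q => [|x p] [|y q]; rewrite ?cats0 //=.
by rewrite !rcons_cat /= !walk_cost_cat addrC.
Qed.

(* A closed walk splits at a repeated vertex, so bounds on simple cycles pass
   to all closed walks. *)
Lemma closed_walk_cost_ge (G : R) : 0 <= G -> (forall x, 0 <= e x x) ->
  (forall p, uniq p -> (1 < size p)%N -> G <= cycle_cost p) ->
  forall x p, (if all (pred1 x) p then 0 else G) <= cycle_cost (x :: p).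
Proof.
move=> G0 e0 He x p; have [m] := ubnP (size p).
elim: m x p => // m IH x p /ltnSE-pm /=.
have IHG y q : (size q < m)%N -> 0 <= walk_cost y (rcons q y).
  by move=> qm; apply: le_trans (IH y q qm); case: ifP.
have [xp|xp] := boolP (x \in p).
  have [p1 [p2 E]] : exists p1 p2, p = p1 ++ x :: p2.
    by case/splitPr: xp => p1 p2; exists p1, p2.
  have : (size p1 < m)%N /\ (size p2 < m)%N.
    by move: pm; rewrite E size_cat /=; lia.
  move=> [p1m p2m]; rewrite E rcons_cat /= walk_cost_cat all_cat /= eqxx /=.
  have := IH x p1 p1m; have := IH x p2 p2m; rewrite /cycle_cost.
  have := IHG x p1 p1m; have := IHG x p2 p2m.
  by do 2 case: (all _ _) => /=; lra.
have [up|/negP up] := boolP (uniq p).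
  case: p xp up pm => [|y p] xp up pm /=; first by rewrite addr0.
  have -> : (y == x) = false.
    by apply/negP => /eqP yx; rewrite yx mem_head in xp.
  have /= := He (x :: y :: p); apply => //.
  by rewrite xp.
have [p1 [y [p2 [p3 E]]]] : exists p1 y p2 p3, p = p1 ++ y :: p2 ++ y :: p3.
  elim: p up {xp pm} => // y p IHp /= /negP.
  rewrite negb_and negbK => /orP[|/negP/IHp]; last first.
    by move=> [p1 [z [p2 [p3 ->]]]]; exists (y :: p1), z, p2, p3.
  by case/splitPr => p1 p2; exists [::], y, p1, p2.
have yx : y != x.
  apply: contra xp => /eqP <-.
  by rewrite E mem_cat mem_head orbT.
have : (size p2 < m)%N /\ (size (p1 ++ y :: p3) < m)%N.
  by move: pm; rewrite E !size_cat /= size_cat /=; lia.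
move=> [p2m p3m].
(* The loop cut out at [y] costs at least 0; what remains still passes through [y != x], so it alone
   pays [G]. *)
have := IHG y p2 p2m; have := IH x _ p3m.
rewrite /cycle_cost E !all_cat /= (negbTE yx) !andbF.
rewrite !(rcons_cat, rcons_cons) !walk_cost_cat; lra.
Qed.

End Walks.

(** * Potentials in the absence of negative closed walks *)

Section Potential.
Context {R : realType} {T : eqType} (e : T -> T -> R).

(** The potential at [b] is the infimum of the costs of walks from [r] to [b], finite because the
    edge [b -> r] closes each of them. *)
Lemma potential_exists (r : T) :
  (forall x p, 0 <= cycle_cost e (x :: p)) ->
  exists f : T -> R, forall a b, f b <= f a + e a b.
Proof.
move=> He; pose W b := [set walk_cost e r (rcons p b) | p in [set: seq T]].
have lbW b : lbound (W b) (- e b r).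
  move=> _ [p _ <-]; have := He r (rcons p b).
  by rewrite /= walk_cost_rcons last_rcons; lra.
exists (fun b => inf (W b)) => a b; rewrite -lerBlDr.
apply: lb_le_inf; first by exists (walk_cost e r (rcons [::] a)), [::].
move=> _ [p _ <-]; rewrite lerBlDr.
apply: ge_inf; first by exists (- e b r); exact: lbW.
by exists (rcons p a) => //; rewrite [LHS]walk_cost_rcons last_rcons.
Qed.

End Potential.

(** * Simple cycles as permutations *)

Section SimpleCycles.
Context {R : realDomainType} {T : finType} (e : T -> T -> R).

Lemma cycle_cost_next (p : seq T) : uniq p ->
  cycle_cost e p = \sum_(z <- p) e z (next p z).
Proof.
case: p => [|x p] up; first by rewrite big_nil.
rewrite /cycle_cost /next.
suff H y : uniq (y :: p) ->
    walk_cost e y (rcons p x) = \sum_(z <- y :: p) e z (next_at z x y p).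
  exact: H.
elim: p y {up} => [|z p IH] y /=.
  by rewrite big_seq1 eqxx addr0.
move=> /andP[yzp uzp]; rewrite big_cons eqxx (IH z uzp); congr (_ + _).
rewrite big_seq [RHS]big_seq; apply: eq_bigr => t tzp /=.
by case: (t =P y) => // E; rewrite -E tzp in yzp.
Qed.

(** The permutation is the successor map along the cycle; it fixes all other points, at no cost. *)
Lemma cycle_cost_perm (p : seq T) : uniq p -> (1 < size p)%N ->
  (forall x, e x x = 0) ->
  exists2 b : {perm T}, b <> 1%g & cycle_cost e p = \sum_z e z (b z).
Proof.
move=> up p1 exx; exists (perm (can_inj (prev_next up))).
  case: p up p1 => [|x [|y p]] //= up _ b1.
  have := congr1 (fun b : {perm T} => b x) b1.
  rewrite permE perm1 /= eqxx => yx.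
  by have /andP[+ _] := up; rewrite yx mem_head.
rewrite cycle_cost_next // [RHS](bigID (mem p)) /= [X in _ + X]big1 ?addr0.
  by rewrite big_uniq //; apply: eq_bigr => z _; rewrite permE.
by move=> z zp; rewrite permE next_nth (negbTE zp) exx.
Qed.

End SimpleCycles.

(** * Mirror images of walks and interleaving pairs *)

Section Mirror.
Context {R : realDomainType} {T : eqType} (e : T -> T -> R) (op : T -> T).
Hypothesis opK : involutive op.
Hypothesis op_neq : forall x, op x != x.
Hypothesis e_op : forall a b, e (op b) (op a) = e a b.

Lemma walk_cost_mirror x p y :
  walk_cost e (op y) (rcons (rev (map op p)) (op x)) =
  walk_cost e x (rcons p y).
Proof.
elim: p x => [|z p IH] x /=; first by rewrite e_op.
by rewrite rev_cons walk_cost_rcons last_rcons e_op IH addrC.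
Qed.

(** The segment between [k] and [op k] is nonempty by sortedness. The opposite of its first vertex
    lies either outside, and the two pairs interleave, or inside, which bounds a shorter segment. *)
Lemma crossing_pairs (L : seq T) : L != [::] -> uniq L ->
  {in L, forall x, op x \in L} -> sorted (fun a b => b != op a) L ->
  exists k l U1 U2 U3 U4 U5,
    L = U1 ++ k :: U2 ++ l :: U3 ++ op k :: U4 ++ op l :: U5.
Proof.
move=> L0 uL opL sL.
have [k [A [L1 [L2 E]]]] : exists k A L1 L2, L = L1 ++ k :: A ++ op k :: L2.
  case: L L0 opL {uL sL} => // k L _ opL; exists k.
  have : op k \in k :: L by rewrite opL ?mem_head.
  rewrite inE (negbTE (op_neq k)) /= => /splitPr[A L2].
  by exists A, [::], L2.
have [m] := ubnP (size A); elim: m k A L1 L2 E => // m IH k A L1 L2 E /ltnSE-Am.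
case: A E Am => [|a A] E Am.
  by have := sL; rewrite E => /cat_sorted2[_]; rewrite /= eqxx.
have /negbTE ak : op a != k.
  apply/negP => /eqP ak; move: uL; rewrite E cat_uniq -ak opK /=.
  by rewrite mem_cat mem_head orbT !andbF.
have /negbTE aopk : op a != op k.
  apply/negP => /eqP/(inv_inj opK) ak'; move: uL.
  by rewrite E cat_uniq -ak' /= mem_head !andbF.
have aL : a \in L by rewrite E !(mem_cat, in_cons) eqxx !orbT.
have := opL a aL.
rewrite {1}E !(mem_cat, in_cons) (negbTE (op_neq a)) ak aopk /=.
move=> /or3P[/splitPr aL1|aA|/splitPr aL2].
- case: aL1 E => V1 V2 E.
  exists (op a), k, V1, V2, [::], A, L2.
  by rewrite E opK -catA.
- have [B [B' EA]] : exists B B', A = B ++ op a :: B'.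
    by case/splitPr: aA => B B'; exists B, B'.
  apply: (IH a B (rcons L1 k) (B' ++ op k :: L2)).
    by rewrite E EA cat_rcons /= -catA.
  by move: Am; rewrite EA /= size_cat /=; lia.
- case: aL2 E => V1 V2 E.
  by exists k, a, L1, [::], A, V1, V2.
Qed.

(** The four vertices cut the cycle into four arcs. The mirror image of the third leads from [l] to
    [k] and closes the first; that of the fourth closes the second. *)
Lemma crossing_cost (G : R) k l U1 U2 U3 U4 U5 :
  (forall x y p q, x != y ->
    G <= walk_cost e x (rcons p y) + walk_cost e y (rcons q x)) ->
  k != l -> op k != l ->
  G *+ 2 <=
    cycle_cost e (U1 ++ k :: U2 ++ l :: U3 ++ op k :: U4 ++ op l :: U5).
Proof.
move=> HG kl okl.
pose V := U5 ++ U1.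
have -> : cycle_cost e (U1 ++ k :: U2 ++ l :: U3 ++ op k :: U4 ++ op l :: U5) =
    walk_cost e k (rcons U2 l) + walk_cost e l (rcons U3 (op k)) +
    walk_cost e (op k) (rcons U4 (op l)) + walk_cost e (op l) (rcons V k).
  rewrite cycle_cost_catC /= -!catA /= -!catA /= -!catA -/V.
  by rewrite !(rcons_cat, rcons_cons, walk_cost_cat) !addrA.
have H p x y q : x != y ->
    G <= walk_cost e x (rcons p y) +
         walk_cost e (op x) (rcons q (op y)).
  move=> xy; rewrite -(walk_cost_mirror (op x)) !opK; exact: HG.
have H1 := H U2 k l U4 kl.
have lopk : l != op k by rewrite eq_sym.
have := H U3 l (op k) V lopk; rewrite opK => H2.
rewrite mulr2n; lra.
Qed.

End Mirror.

(** * A function on [I_n] with slack [s] *)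

Section SlackPotential.
Context {R : realType} {n : nat}.
Variables (w : signed_index n -> signed_index n -> R) (s : R).
Hypothesis n1 : (1 <= n)%N.
Hypothesis s0 : 0 <= s.
Hypothesis w_sym : forall i j, w i j = w j i.
Hypothesis w_triangle : forall i j k, w i k <= w i j + w j k.
Hypothesis w_gap : forall alpha, alpha <> index_opp_perm n ->
  \sum_i w i (alpha i) + (2 * n)%:R * s <= \sum_i w i (index_opp i).

Local Notation op := (@index_opp n).
Local Notation opK := (@index_oppK n).

Lemma index_opp_neq i : op i != i.
Proof. by case: i => k []; rewrite xpair_eqE andbF. Qed.

Lemma index_opp_eq i j : (op i == j) = (i == op j).
Proof. by apply/eqP/eqP => [<-|->]; rewrite opK. Qed.

Lemma card_signed_index : #|signed_index n| = (2 * n).+2.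
Proof. by rewrite card_prod card_ord card_bool mulnC mulnS. Qed.

Let gain a b := (w a (op a) + w b (op b)) / 2 - w a (op b).

Let gain_op a b : gain (op b) (op a) = gain a b.
Proof. by rewrite /gain !opK !(w_sym (op _)) [w b _ + _]addrC. Qed.

Let gain_cycle p : uniq p -> (1 < size p)%N ->
  (2 * n)%:R * s <= cycle_cost gain p.
Proof.
move=> up p1; have gxx x : gain x x = 0 by rewrite /gain; lra.
have [b b1 ->] := cycle_cost_perm gain p up p1 gxx.
(* This permutation is [i |-> op (b i)]; its gap is the total gain of [b], half of the sum being
   reindexed along [b]. *)
have /w_gap : (b * index_opp_perm n)%g <> index_opp_perm n.
  by move/(canRL (mulgK _)); rewrite mulgV.
under eq_bigr do rewrite permM permE.
rewrite /gain sumrB -mulr_suml big_split /=.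
have -> : \sum_i w (b i) (op (b i)) = \sum_i w i (op i).
  by rewrite [RHS](reindex_perm b).
lra.
Qed.

Let gain_closed_walk x y p q : x != y ->
  (2 * n)%:R * s <= walk_cost gain x (rcons p y) + walk_cost gain y (rcons q x).
Proof.
move=> xy.
have gxx z : 0 <= gain z z by rewrite /gain; lra.
have G0 : 0 <= (2 * n)%:R * s by rewrite mulr_ge0.
have := closed_walk_cost_ge gain _ G0 gxx gain_cycle x (p ++ y :: q).
by rewrite all_cat /= eq_sym (negbTE xy) andbF rcons_cat /= walk_cost_cat.
Qed.

(* Simple cycles of length at most [2 * n] have enough gain by hypothesis; the
   longer ones that avoid the edges [a -> - a] contain crossing pairs. *)
Let gain_long_cycle (p : seq (signed_index n)) : uniq p -> (2 * n < size p)%N ->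
  path.cycle (fun a b => b != op a) p ->
  (2 * n)%:R * s *+ 2 <= cycle_cost gain p.
Proof.
move=> up pn cp.
have crossP (U0 L : seq (signed_index n)) : L != [::] -> uniq L ->
    {in L, forall x, op x \in L} -> sorted (fun a b => b != op a) L ->
    (2 * n)%:R * s *+ 2 <= cycle_cost gain (U0 ++ L).
  move=> L0 uL opL sL.
  have [k [l [U1 [U2 [U3 [U4 [U5 E]]]]]]] :=
    crossing_pairs op opK index_opp_neq L L0 uL opL sL.
  rewrite E catA; apply: (crossing_cost gain op opK gain_op).
  - exact: gain_closed_walk.
  - apply/eqP => kl; move: uL.
    by rewrite E cat_uniq kl /= mem_cat mem_head !orbT !andbF.
  - apply/eqP => kl; move: uL.
    rewrite E cat_uniq -kl => /and3P[_ _ /= /andP[_]].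
    by rewrite cat_uniq /= mem_cat mem_head orbT !andbF.
have [/forallP fullp|] := boolP [forall x, x \in p].
  apply: (crossP [::]) => //.
  - by case: (p) pn.
  - by case: (p) cp => //= x q; rewrite rcons_path => /andP[].
(* With more than [2 * n] vertices on the cycle, only [y] is missing. Once [op y] is rotated to the
   front, the rest is closed under [op]. *)
rewrite negb_forall => /existsP[y yp].
have inp z : z != y -> z \in p.
  move=> zy; apply/negPn/negP => zp.
  have uzyp : uniq (z :: y :: p) by rewrite /= inE (negbTE zy) zp yp.
  have := max_card (mem (z :: y :: p)).
  by rewrite (card_uniqP uzyp) card_signed_index /= !ltnS leqNgt pn.
have := inp (op y) (index_opp_neq y).
move=> /rot_to[i L E].
have <- : cycle_cost gain (op y :: L) = cycle_cost gain p.
  by rewrite -E /rot cycle_cost_catC cat_take_drop.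
have uL : uniq (op y :: L) by rewrite -E rot_uniq.
have inL z : z \in op y :: L = (z \in p) by rewrite -E mem_rot.
apply: (crossP [:: op y]).
- move: (congr1 size E) pn; rewrite size_rot => ->.
  by case: (L) => //=; rewrite ltnS leqn0 muln_eq0 /= eqn0Ngt n1.
- by case/andP: uL.
- move=> z zL; case/andP: uL => yL _.
  have zy : z != op y by apply: contra yL => /eqP <-.
  have : op z \in op y :: L.
    by rewrite inL inp // index_opp_eq.
  rewrite inE (inj_eq (inv_inj opK)) => /orP[/eqP zy'|//].
  by move: yp; rewrite -zy' -inL inE zL orbT.
- move: cp; rewrite -(rot_cycle i) E /= rcons_path => /andP[+ _].
  exact: path_sorted.
Qed.

(* The edges [a -> - a] carry no constraint; the penalty keeps cycles through
   them nonnegative without having to leave the complete digraph. *)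
Let penalty : R := (2 * n).+2%:R * s.

Let cost a b := gain a b -
  (if b == a then 0 else if b == op a then s - penalty else s).

Let cost_op a b : cost (op b) (op a) = cost a b.
Proof.
by rewrite /cost gain_op opK (inj_eq (inv_inj opK)) [a == b]eq_sym
  [op a == b]eq_sym.
Qed.

Let penalty0 : 0 <= penalty. Proof. by rewrite mulr_ge0. Qed.

(** Each edge is charged at most [s], and a walk through some edge [a -> op a] collects the penalty
    at least once. *)
Let walk_cost_gain x p :
  walk_cost gain x p - (size p)%:R * s +
    (if path (fun a b => b != op a) x p then 0 else penalty)
  <= walk_cost cost x p.
Proof.
elim: p x => [|y p IH] x /=; first by rewrite mul0r subrr addr0.
have := IH y; rewrite -natr1 mulrDl mul1r /cost.
have := s0; have := penalty0; case: (eqVneq y x) => [->|_].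
  by rewrite eq_sym index_opp_neq /=; lra.
case: (eqVneq y (op x)) => _ /=; last by lra.
by case: ifP; lra.
Qed.

Let cost_cycle p : uniq p -> (1 < size p)%N -> 0 <= cycle_cost cost p.
Proof.
move=> up p1; have Gp := gain_cycle p up p1.
have pn : (size p <= (2 * n).+2)%N.
  by rewrite -(card_uniqP up) -card_signed_index max_card.
have := @gain_long_cycle p up.
have ps : (size p)%:R * s <= penalty by rewrite ler_wpM2r ?ler_nat.
case: p up p1 Gp pn ps => // x p up p1 Gp pn ps /= long.
have := walk_cost_gain x (rcons p x); rewrite size_rcons.
case: ifP => [cp|_]; last first.
  have : 0 <= (2 * n)%:R * s by rewrite mulr_ge0.
  by move: Gp ps => /=; lra.
have [small|large] := leqP (size p).+1 (2 * n).
  have : (size p).+1%:R * s <= (2 * n)%:R * s by rewrite ler_wpM2r ?ler_nat.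
  by move: Gp => /=; lra.
(* Here [2 * n + 2 <= 4 * n], as [n >= 1]. *)
have : penalty <= (2 * n)%:R * s *+ 2.
  rewrite -mulrnAl -mulrnA ler_wpM2r ?ler_nat //; lia.
by move: ps (long large cp) => /=; lra.
Qed.

Lemma slack_potential : exists f : signed_index n -> R,
  [/\ forall i, f i + f (op i) = w i (op i),
      forall i j, j != i -> j != op i -> w i j + s <= f i + f j &
      forall i, s <= f i].
Proof.
have c0 x : 0 <= cost x x by rewrite /cost /gain eqxx; lra.
have Hc x p : 0 <= cycle_cost cost (x :: p).
  by have := closed_walk_cost_ge cost 0 (lexx 0) c0 cost_cycle x p; case: ifP.
have [phi Hphi] := potential_exists cost (ord0, false) Hc.
(* The odd part of [phi] makes the pair sums exact; the constraints survive because [cost] is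
   invariant under mirroring. *)
pose f a := w a (op a) / 2 + (phi a - phi (op a)) / 2.
have f1 i : f i + f (op i) = w i (op i).
  by rewrite /f opK (w_sym (op i)); lra.
have f2 i j : j != i -> j != op i -> w i j + s <= f i + f j.
  move=> ji jopi; have := Hphi i (op j); have := Hphi j (op i).
  rewrite -(cost_op j) opK /cost /gain opK.
  rewrite index_opp_eq (negbTE jopi) (inj_eq (inv_inj opK)) (negbTE ji).
  by rewrite /f (w_sym (op j)); lra.
exists f; split=> // i.
(* Since [n >= 1] there is an index off the axis of [i]. Adding the bounds for [i, b] and [i, op b]
   and applying the triangle inequality to [w b (op b)] gives [2 * s <= 2 * f i]. *)
have [b [bi bopi]] : exists b, b != i /\ b != op i.
  have h1 : (1 < n.+1)%N by lia.
  pose k : 'I_n.+1 := if i.1 == ord0 then Ordinal h1 else ord0.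
  exists (k, false); rewrite /k; case: i k => i b _ /=.
  rewrite !xpair_eqE; case: (eqVneq i ord0) => [->|i0].
    by [].
  by rewrite eq_sym (negbTE i0).
have := f2 i b bi bopi; have := f2 i (op b); rewrite index_opp_eq bopi.
rewrite (inj_eq (inv_inj opK)) bi => /(_ isT isT).
have := f1 b; have := w_triangle b i (op b); rewrite (w_sym b i); lra.
Qed.

End SlackPotential.

(** * A 1-Lipschitz retraction of admissible functions onto the hull *)

Section Retraction.
Context {R : realType} {X : metricType R}.
Implicit Types f g : X -> R.

(** The members of the hull are the admissible functions equal to their conjugate. *)
Definition hull_conj f (x : X) : R := sup [set mdist x y - f y | y in [set: X]].

(** The conjugate of an admissible [f] may fail to be admissible, but [f x + hull_conj f y] and
    [hull_conj f x + f y] are both at least [mdist x y], so the average is admissible. *)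
Definition hull_step f (x : X) : R := (f x + hull_conj f x) / 2.

Lemma hull_admissible_ge0 f x : hull_admissible f -> 0 <= f x.
Proof. by move=> /(_ x x); rewrite mdistxx; lra. Qed.

Lemma hull_conj_le f x c : (forall y, mdist x y - f y <= c) ->
  hull_conj f x <= c.
Proof.
move=> H; apply: ge_sup; first by exists (mdist x x - f x), x.
by move=> _ [y _ <-].
Qed.

Lemma hull_conj_ge f x y : hull_admissible f ->
  mdist x y - f y <= hull_conj f x.
Proof.
move=> fadm; apply: sup_upper_bound; last by exists y.
split; first by exists (mdist x y - f y), y.
by exists (f x) => _ [z _ <-]; have := fadm x z; lra.
Qed.

Lemma hull_conj_le_self f x : hull_admissible f -> hull_conj f x <= f x.
Proof. by move=> fadm; apply: hull_conj_le => y; have := fadm x y; lra. Qed.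

(* Constant shifts make this both the antitonicity of the conjugate ([c = 0])
   and its 1-Lipschitz estimate. *)
Lemma hull_conj_shift f g c x : hull_admissible g ->
  (forall y, g y <= f y + c) ->
  hull_conj f x <= hull_conj g x + c.
Proof.
move=> gadm gf; apply: hull_conj_le => y.
by have := hull_conj_ge g x y gadm; have := gf y; lra.
Qed.

Lemma hull_step_admissible f : hull_admissible f ->
  hull_admissible (hull_step f).
Proof.
move=> fadm x y; rewrite /hull_step.
have := hull_conj_ge f x y fadm; have := hull_conj_ge f y x fadm.
by rewrite (metric_sym y x); lra.
Qed.

Definition hull_iter f (m : nat) : X -> R := iter m hull_step f.

Lemma hull_iter_admissible f m : hull_admissible f ->
  hull_admissible (hull_iter f m).
Proof. by move=> fadm; elim: m => //= m; apply: hull_step_admissible. Qed.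

Lemma hull_iterS_le f m x : hull_admissible f ->
  hull_iter f m.+1 x <= hull_iter f m x.
Proof.
move=> /(hull_iter_admissible _ m) fadm; rewrite /hull_iter /= /hull_step.
by have := hull_conj_le_self _ x fadm; rewrite /hull_iter; lra.
Qed.

Lemma hull_iter_le f m x : hull_admissible f -> hull_iter f m x <= f x.
Proof.
move=> fadm; elim: m => [|m IH]; first exact: lexx.
exact: le_trans (hull_iterS_le f m x fadm) IH.
Qed.

Lemma hull_iter_nonincreasing f x m m' : hull_admissible f -> (m <= m')%N ->
  hull_iter f m' x <= hull_iter f m x.
Proof.
move=> fadm /subnK <-; elim: (m' - m)%N => [|k IH]; first exact: lexx.
exact: le_trans (hull_iterS_le f _ x fadm) IH.
Qed.

Lemma hull_iter_shift f g c m : hull_admissible f -> hull_admissible g ->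
  (forall y, `|f y - g y| <= c) ->
  forall y, `|hull_iter f m y - hull_iter g m y| <= c.
Proof.
move=> fadm gadm fg; elim: m => //= m IH y.
have fm := hull_iter_admissible f m fadm;
  have gm := hull_iter_admissible g m gadm.
have fgm z : hull_iter g m z <= hull_iter f m z + c.
  by have := IH z; rewrite ler_norml; lra.
have gfm z : hull_iter f m z <= hull_iter g m z + c.
  by have := IH z; rewrite ler_norml; lra.
have := hull_conj_shift _ _ c y gm fgm; have := hull_conj_shift _ _ c y fm gfm.
have := IH y; rewrite /hull_iter /= /hull_step !ler_norml; lra.
Qed.

(** Averaging halves the gap, and the conjugate only grows as the function decreases. *)
Lemma hull_iter_gap f m x : hull_admissible f ->
  hull_iter f m x - hull_conj (hull_iter f m) x <=
    (f x - hull_conj f x) / 2 ^+ m.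
Proof.
move=> fadm; elim: m => [|m IH]; first by rewrite expr0 divr1.
have fm := hull_iter_admissible f m fadm.
have fm1 := hull_iter_admissible f m.+1 fadm.
have : hull_conj (hull_iter f m) x <= hull_conj (hull_iter f m.+1) x + 0.
  by apply: hull_conj_shift => // y; rewrite addr0 hull_iterS_le.
rewrite exprS invfM [2^-1 * _]mulrC mulrA.
have -> : hull_iter f m.+1 x = hull_step (hull_iter f m) x by [].
by move: IH; rewrite /hull_step; lra.
Qed.

Definition hull_limit f (x : X) : R :=
  inf [set hull_iter f m x | m in [set: nat]].

Lemma hull_limit_le_iter f m x : hull_admissible f ->
  hull_limit f x <= hull_iter f m x.
Proof.
move=> fadm; apply: ge_inf; last by exists m.
by exists 0 => _ [k _ <-]; exact/hull_admissible_ge0/hull_iter_admissible.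
Qed.

Lemma hull_limit_ge f x c : (forall m, c <= hull_iter f m x) ->
  c <= hull_limit f x.
Proof.
move=> H; apply: lb_le_inf; first by exists (hull_iter f 0 x), 0%N.
by move=> _ [m _ <-].
Qed.

Lemma hull_limit_le f x : hull_admissible f -> hull_limit f x <= f x.
Proof. exact: hull_limit_le_iter f 0 x. Qed.

Lemma hull_limit_admissible f : hull_admissible f ->
  hull_admissible (hull_limit f).
Proof.
move=> fadm x y; rewrite -lerBlDr; apply: hull_limit_ge => m.
rewrite lerBlDr addrC -lerBlDr; apply: hull_limit_ge => m'; rewrite lerBlDr.
have := hull_iter_admissible f (maxn m m') fadm x y.
have := hull_iter_nonincreasing f x m (maxn m m') fadm (leq_maxl _ _).
have := hull_iter_nonincreasing f y m' (maxn m m') fadm (leq_maxr _ _).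
lra.
Qed.

Lemma hull_limit_in_hull f : hull_admissible f -> hull_set (hull_limit f).
Proof.
move=> fadm; have ladm := hull_limit_admissible f fadm; split=> // g gadm gf.
apply/funext => x; apply/eqP; rewrite eq_le gf /=.
(* This gives minimality: if [g <= hull_limit f], then [hull_conj (hull_limit f) <= hull_conj g <=
   g]. *)
suff lconj : hull_limit f x <= hull_conj (hull_limit f) x.
  apply: le_trans lconj _; apply: le_trans (hull_conj_le_self g x gadm).
  rewrite -[leRHS]addr0; apply: hull_conj_shift => // y.
  by rewrite addr0.
pose D := f x - hull_conj f x.
have D0 : 0 <= D by rewrite subr_ge0 hull_conj_le_self.
apply/ler_addgt0Pr => eps eps0.
have [m] : exists m : nat, D / 2 ^+ m <= eps.
  have [m Dm] : exists m : nat, D / eps < m%:R.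
    by exists (Num.truncn (D / eps)).+1; rewrite truncnS_gt.
  exists m; rewrite ler_pdivrMr ?exprn_gt0 // mulrC -ler_pdivrMr //.
  apply: le_trans (ltW Dm) _; rewrite -natrX ler_nat.
  exact/ltnW/ltn_expl.
have := hull_iter_gap f m x fadm.
have : hull_conj (hull_iter f m) x <= hull_conj (hull_limit f) x + 0.
  apply: hull_conj_shift => // y.
  by rewrite addr0 hull_limit_le_iter.
have := hull_limit_le_iter f m x fadm.
by rewrite -/D; lra.
Qed.

Lemma hull_limit_lipschitz f g c : hull_admissible f -> hull_admissible g ->
  (forall y, `|f y - g y| <= c) ->
  forall y, `|hull_limit f y - hull_limit g y| <= c.
Proof.
move=> fadm gadm fg y.
have H := hull_iter_shift f g c _ fadm gadm fg.
rewrite ler_distlC; apply/andP; split.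
  apply: hull_limit_ge => m.
  by have := hull_limit_le_iter f m y fadm; have := H m y; rewrite ler_norml;
    lra.
rewrite -lerBlDr; apply: hull_limit_ge => m.
by have := hull_limit_le_iter g m y gadm; have := H m y; rewrite ler_norml; lra.
Qed.

End Retraction.

(** * From functions on finitely many points to members of the hull *)

Section Extension.
Context {R : realType} {X : metricType R} {I : finType} (x : I -> X) (i0 : I).
Implicit Types u v : I -> R.

(** McShane's extension formula; the default of the minimum is one of its terms. *)
Definition lipschitz_extension u (z : X) : R :=
  \big[Num.min/u i0 + mdist z (x i0)]_i (u i + mdist z (x i)).

Lemma lipschitz_extension_le u z i :
  lipschitz_extension u z <= u i + mdist z (x i).
Proof. exact: bigmin_le_cond. Qed.

Lemma lipschitz_extension_ge u z c :
  (forall i, c <= u i + mdist z (x i)) -> c <= lipschitz_extension u z.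
Proof. by move=> H; apply: le_bigmin => [|i _]; apply: H. Qed.

Lemma lipschitz_extension_admissible u :
  (forall i j, mdist (x i) (x j) <= u i + u j) ->
  hull_admissible (lipschitz_extension u).
Proof.
move=> Hu y z; rewrite -lerBlDr; apply: lipschitz_extension_ge => i.
rewrite lerBlDr addrC -lerBlDr; apply: lipschitz_extension_ge => j.
have := metric_triangle y (x i) z; have := metric_triangle (x i) (x j) z.
by have := Hu i j; rewrite (metric_sym (x j) z); lra.
Qed.

Definition hull_extension u : X -> R := hull_limit (lipschitz_extension u).

Lemma hull_extension_in_hull u : (forall i j, mdist (x i) (x j) <= u i + u j) ->
  hull_set (hull_extension u).
Proof. by move=> /lipschitz_extension_admissible;
  exact: hull_limit_in_hull. Qed.

(** Extension and retraction can only lower the values at the points, and a tight pair leaves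
    neither of its values room to drop. *)
Lemma hull_extension_eq u i j : (forall i j, mdist (x i) (x j) <= u i + u j) ->
  u i + u j = mdist (x i) (x j) -> hull_extension u (x i) = u i.
Proof.
move=> Hu uij; have adm := lipschitz_extension_admissible u Hu.
have le k : hull_extension u (x k) <= u k.
  apply: le_trans (hull_limit_le _ (x k) adm) _.
  by have := lipschitz_extension_le u (x k) k; rewrite mdistxx addr0.
have := hull_limit_admissible _ adm (x i) (x j).
rewrite -/(hull_extension u) => ij; apply: le_anti.
by have := le i; have := le j; lra.
Qed.

Lemma hull_extension_lipschitz u v c :
  (forall i j, mdist (x i) (x j) <= u i + u j) ->
  (forall i j, mdist (x i) (x j) <= v i + v j) ->
  (forall i, `|u i - v i| <= c) ->
  forall z, `|hull_extension u z - hull_extension v z| <= c.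
Proof.
move=> Hu Hv uv; apply: hull_limit_lipschitz;
  [exact: lipschitz_extension_admissible..|] => z.
rewrite ler_distlC; apply/andP; split.
  apply: lipschitz_extension_ge => i.
  have := lipschitz_extension_le u z i; have := uv i; rewrite ler_norml; lra.
rewrite -lerBlDr; apply: lipschitz_extension_ge => i.
by have := lipschitz_extension_le v z i; have := uv i; rewrite ler_norml; lra.
Qed.

End Extension.

(** * Coordinates in the sup norm *)

Lemma rV_norm_ge (R : realType) (m : nat) (v : 'rV[R]_m) k : `|v 0 k| <= `|v|.
Proof.
rewrite [leRHS]/Num.Def.normr /= mx_normrE.
exact: (le_bigmax _ (fun ij : 'I_1 * 'I_m => `|v ij.1 ij.2|) (0, k)).
Qed.

Lemma rV_norm_le (R : realType) (m : nat) (v : 'rV[R]_m) c : 0 <= c ->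
  (forall k, `|v 0 k| <= c) -> `|v| <= c.
Proof.
move=> c0 H; rewrite [leLHS]/Num.Def.normr /= mx_normrE.
by apply: bigmax_le => // -[i k] _ /=; rewrite ord1.
Qed.

Lemma cross_polytope_coord (R : realType) (m : nat) (s : R) (v : 'rV[R]_m) :
  0 <= s -> cross_polytope m s v ->
  exists i, forall k, `|v 0 k| = if k == i then s else 0.
Proof.
move=> s0 [i Hv]; exists i => k.
by case: Hv => ->; rewrite !mxE eqxx /= ?normrN normrM (ger0_norm s0);
  case: eqP => _; rewrite ?normr1 ?normr0 ?mulr1 ?mulr0.
Qed.

(** * From slack to a copy of the cross polytope *)

Section CrossPolytopeCopy.
Context {R : realType} {X : metricType R} {n : nat}.
Variables (x : signed_index n -> X) (f : signed_index n -> R) (s : R).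
Hypothesis s0 : 0 <= s.
Hypothesis f_opp : forall i,
  f i + f (index_opp i) = mdist (x i) (x (index_opp i)).
Hypothesis f_slack : forall i j, j != i -> j != index_opp i ->
  mdist (x i) (x j) + s <= f i + f j.
Hypothesis f_ge : forall i, s <= f i.

Let tilt (v : 'rV[R]_n.+1) (i : signed_index n) : R :=
  f i + (if i.2 then - v 0 i.1 else v 0 i.1).

Let tilt_opp v i :
  tilt v i + tilt v (index_opp i) = mdist (x i) (x (index_opp i)).
Proof. by rewrite -f_opp /tilt; case: i => k [] /=; lra. Qed.

Let tilt_admissible v : cross_polytope n.+1 s v ->
  forall i j, mdist (x i) (x j) <= tilt v i + tilt v j.
Proof.
move=> vP i j; have [r vE] := cross_polytope_coord _ _ _ _ s0 vP.
have tilt_ge i' : f i' - `|v 0 i'.1| <= tilt v i'.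
  rewrite /tilt; have := lexx `|v 0 i'.1|; rewrite {1}ler_norml.
  by case: ifP; lra.
have [->|ji] := eqVneq j i.
  rewrite mdistxx; have := tilt_ge i; have := f_ge i.
  by rewrite vE; have := s0; case: eqP => _; lra.
have [->|jopi] := eqVneq j (index_opp i); first by rewrite tilt_opp.
have ij1 : i.1 != j.1.
  case: i j ji jopi => k b [l c]; rewrite /index_opp /= !xpair_eqE (eq_sym k).
  by case: (l == k) => //=; case: b; case: c.
(* On different axes at most one of the two coordinates is nonzero, so the slack [s] is used up only
   once. *)
have : `|v 0 i.1| + `|v 0 j.1| <= s.
  rewrite !vE; have [ir|_] := eqVneq i.1 r; last by rewrite add0r; case: ifP.
  by rewrite -ir eq_sym (negbTE ij1) addr0.
by have := tilt_ge i; have := tilt_ge j; have := f_slack i j ji jopi; lra.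
Qed.

(** Distances do not grow because extension and retraction are 1-Lipschitz; they do not shrink
    because each pair [k], [-k] is tight, so the tilted values at the points are kept. *)
Lemma cross_polytope_copy_of_slack :
  contains_isometric_copy (injective_hull X) (cross_polytope n.+1 s).
Proof.
pose i0 : signed_index n := (ord0, false).
pose phi (a : cross_polytope n.+1 s) : injective_hull X :=
  exist (fun h => h \in @hull_set R X) _
    (mem_set (hull_extension_in_hull x i0 (tilt (\val a))
      (tilt_admissible _ (set_valP a)))).
exists (range phi); exists phi => // a b.
have adm (c : cross_polytope n.+1 s) := tilt_admissible _ (set_valP c).
have tiltB i : `|tilt (\val a) i - tilt (\val b) i| =
    `|(\val a - \val b : 'rV[R]_n.+1) 0 i.1|.
  rewrite !mxE /tilt; case: ifP => _; last by congr `|_|; lra.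
  by rewrite -normrN; congr `|_|; lra.
apply/eqP; rewrite mdist_hullE eq_le; apply/andP; split.
  apply: hull_dist_le => // z.
  apply: (hull_extension_lipschitz x i0) => // i.
  by rewrite tiltB rV_norm_ge.
apply: rV_norm_le; first exact: hull_dist_ge0.
move=> k; apply: le_trans (hull_dist_ub (phi a) (phi b) (x (k, false))).
rewrite -(tiltB (k, false)).
by rewrite -!(hull_extension_eq x i0 _ _ (index_opp (k, false)) _ (tilt_opp _ _)).
Qed.

End CrossPolytopeCopy.

(** * Hull distances approximated by distances in [X] *)

Section HullApproximation.
Context {R : realType} {X : metricType R}.
Implicit Types f g : injective_hull X.

Lemma hull_fun_tight f y (eps : R) : 0 < eps ->
  exists z, hull_fun f y + hull_fun f z - eps < mdist y z.
Proof.
move=> eps0; apply: contrapT => /forallNP H.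
have {}H z : mdist y z <= hull_fun f y + hull_fun f z - eps.
  by rewrite leNgt; apply/negP/H.
have [fadm fmin] := hull_funP f.
(* Only half of [eps], since the pair [y, y] loses it twice. *)
pose g z := if z == y then hull_fun f y - eps / 2 else hull_fun f z.
have gf : g = hull_fun f.
  apply: fmin => [a b|z]; rewrite /g; last by case: eqP => [->|_]; lra.
  case: eqP => [->|_]; case: eqP => [->|_].
  - by have := H y; lra.
  - by have := H b; lra.
  - by have := H a; rewrite metric_sym; lra.
  - exact: fadm.
have := congr1 (fun h => h y) gf; rewrite /g eqxx; lra.
Qed.

(** Where [|f - g|] is almost its supremum, tightness trades the larger value for a distance minus a
    value at another point. *)
Lemma hull_dist_approx f g (eps : R) : 0 < eps -> 0 < mdist f g ->
  exists y z, mdist f g - eps < mdist y z - hull_fun f y - hull_fun g z.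
Proof.
move=> eps0 fg0.
have [[w _]|X0] := pselect (exists x : X, True); last first.
  by move: fg0; rewrite mdist_hullE hull_dist_empty // ltxx.
have eps20 : 0 < eps / 2 by lra.
have [_ [z _ <-]] := sup_adherent eps20 (hull_dist_has_sup f g w).
rewrite -/(hull_dist f g) -mdist_hullE.
have [fg|gf] := leP 0 (hull_fun f z - hull_fun g z).
  rewrite ger0_norm // => Hz; have [y Hy] := hull_fun_tight f z _ eps20.
  by exists y, z; rewrite (metric_sym y); lra.
rewrite ltr0_norm // => Hz; have [y Hy] := hull_fun_tight g z _ eps20.
by exists z, y; lra.
Qed.

Lemma mdist_hull_fun_le f g y z :
  mdist y z <= hull_fun f y + hull_fun g z + mdist f g.
Proof.
have [fadm _] := hull_funP f; have := fadm y z.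
by have := hull_dist_ub f g z; rewrite mdist_hullE ler_norml; lra.
Qed.

End HullApproximation.

(** * Hyperbolicity excludes large cross polytopes *)

Lemma hyperbolic_no_cross_polytope (R : realType) (n : nat) (delta : R)
    (X : metricType R) : 0 <= delta -> hyperbolic X n delta ->
  forall s : R, delta < s ->
    ~ contains_isometric_copy (injective_hull X) (cross_polytope n.+1 s).
Proof.
move=> delta0 Xhyp s deltas [_ [phi phi_iso _]].
have s0 : 0 < s by lra.
pose vertex (i : signed_index n) : 'rV[R]_n.+1 :=
  if i.2 then - (s *: delta_mx 0 i.1) else s *: delta_mx 0 i.1.
have vertexP i : cross_polytope n.+1 s (vertex i).
  by exists i.1; rewrite /vertex; case: ifP => _; [right|left].
pose F i : injective_hull X := 
  phi (exist (fun v => v \in cross_polytope n.+1 s) _ (mem_set (vertexP i))).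
have dF i j : mdist (F i) (F j) = `|vertex i - vertex j| by exact: phi_iso.
have vertexE i k : vertex i 0 k =
    if k == i.1 then (if i.2 then - s else s) else 0.
  by rewrite /vertex; case: ifP => _; rewrite !mxE eqxx /=;
    case: eqP => _; rewrite ?mulr1 ?mulr0 ?oppr0.
have dF_opp i : s * 2 <= mdist (F i) (F (index_opp i)).
  rewrite dF; apply: le_trans (rV_norm_ge _ _ _ i.1).
  rewrite !mxE !vertexE /= eqxx; case: (i.2) => /=.
    by rewrite -normrN; apply: le_trans (ler_norm _); lra.
  by apply: le_trans (ler_norm _); lra.
have dF_le i j : j != index_opp i -> mdist (F i) (F j) <= s.
  move=> ji; rewrite dF; apply: rV_norm_le; first exact: ltW.
  move=> k; rewrite !mxE !vertexE.
  move: ji; case: i j => i b [j c]; rewrite /index_opp xpair_eqE /=.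
  have abs_s (d : bool) : `|if d then - s else s| = s.
    by case: d; rewrite ?normrN gtr0_norm.
  have [<-|_] := eqVneq k i; have [_|_] := eqVneq k j;
    rewrite ?eqxx ?subr0 ?sub0r ?subrr ?normrN ?abs_s ?normr0 ?(ltW s0) //.
  by case: b; case: c; rewrite //= subrr normr0 (ltW s0).
(* The total error allowed, shared equally by the indices: [2 * delta + eps] stays below [2 * s]. *)
pose eps := s - delta.
pose N : R := #|signed_index n|%:R.
have N0 : 0 < N by rewrite ltr0n card_signed_index.
have epsN : 0 < eps / N by rewrite divr_gt0 // /eps; lra.
have [xs Hxs] : exists xs : signed_index n -> X, forall i,
    mdist (F i) (F (index_opp i)) - eps / N <
    mdist (xs i) (xs (index_opp i)) - hull_fun (F i) (xs i) -
      hull_fun (F (index_opp i)) (xs (index_opp i)).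
  (* The points for [k] and [-k] are found together, so the choice runs over the axes. *)
  have /choice[yz Hyz] (k : 'I_n.+1) : exists yz : X * X,
      mdist (F (k, false)) (F (k, true)) - eps / N <
      mdist yz.1 yz.2 - hull_fun (F (k, false)) yz.1 - hull_fun (F (k, true)) yz.2.
    have [|y [z yz]] := hull_dist_approx (F (k, false)) (F (k, true)) _ epsN.
      by apply: lt_le_trans (dF_opp (k, false)); lra.
    by exists (y, z).
  exists (fun i => if i.2 then (yz i.1).2 else (yz i.1).1) => -[k []] /=.
    have := Hyz k; rewrite (metric_sym (F (k, true))) (metric_sym (yz k).2).
    by rewrite /index_opp /=; lra.
  exact: Hyz.
have [alpha alpha_opp sum_le] := Xhyp xs.
have [i ai] : exists i, alpha i != index_opp i.
  apply: contrapT => /forallNP H; apply: alpha_opp; apply/permP => i.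
  by rewrite permE; apply/eqP/negPn/negP/H.
(* The second index that loses [s]: as [alpha] sends [j] to [-i], [j] differs from [i] and [alpha j]
   from [-j]. *)
pose j := (alpha^-1)%g (index_opp i).
have ji : j != i by rewrite (canF_eq (permKV alpha)) eq_sym.
have aj : alpha j != index_opp j.
  by rewrite permKV (inj_eq (inv_inj (@index_oppK n))) eq_sym.
have term_ge k : alpha k != index_opp k ->
    s <= mdist (F k) (F (index_opp k)) - mdist (F k) (F (alpha k)).
  by move=> ak; have := dF_opp k; have := dF_le k _ ak; lra.
have gain_ge : s * 2 <= \sum_k mdist (F k) (F (index_opp k)) -
    \sum_k mdist (F k) (F (alpha k)).
  rewrite -sumrB (bigD1 i) //= (bigD1 j) //=.
  have rest : 0 <= \sum_(k | (k != i) && (k != j))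
      (mdist (F k) (F (index_opp k)) - mdist (F k) (F (alpha k))).
    apply: sumr_ge0 => k _; have [->|ak] := eqVneq (alpha k) (index_opp k).
      by rewrite subrr.
    by have := term_ge k ak; lra.
  by have := term_ge i ai; have := term_ge j aj; lra.
(* Reindexing along negation or [alpha] preserves [H], so it cancels between the two estimates. *)
pose H := \sum_k hull_fun (F k) (xs k).
have upper : \sum_k mdist (F k) (F (index_opp k)) - eps <=
    \sum_k mdist (xs k) (xs (index_opp k)) - H - H.
  have -> : eps = \sum_(k : signed_index n) eps / N.
    by rewrite sumr_const -mulr_natr divfK // gt_eqF.
  have HE : H = \sum_k hull_fun (F (index_opp k)) (xs (index_opp k)).
    exact: reindex_inj (inv_inj (@index_oppK n)).
  rewrite {2}HE -!sumrB.
  by apply: ler_sum => k _; exact/ltW/Hxs.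
have lower : \sum_k mdist (xs k) (xs (alpha k)) <=
    H + H + \sum_k mdist (F k) (F (alpha k)).
  have HE : H = \sum_k hull_fun (F (alpha k)) (xs (alpha k)).
    by rewrite [LHS](reindex_perm alpha).
  rewrite {2}HE -!big_split.
  by apply: ler_sum => k _; exact: mdist_hull_fun_le.
by rewrite /eps in upper; lra.
Qed.

(** * The converse *)

Lemma gap_ratio (R : realFieldType) (T : finType) (P : pred T) (F : T -> R)
    (N delta : R) : 0 < N -> (forall t, P t -> N * delta < F t) ->
  exists2 s, delta < s & forall t, P t -> N * s <= F t.
Proof.
(* The least of finitely many ratios still exceeds [delta]; the default [delta + 1] covers an empty
   [P]. *)
move=> N0 HF; exists (\big[Num.min/delta + 1]_(t | P t) (F t / N)).
  apply: lt_bigmin => [|t Pt]; first by rewrite ltrDl.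
  by rewrite ltr_pdivlMr // mulrC HF.
move=> t Pt; rewrite mulrC -ler_pdivlMr //.
exact: bigmin_le_cond.
Qed.

Lemma no_cross_polytope_hyperbolic (R : realType) (n : nat) (delta : R)
    (X : metricType R) : (1 <= n)%N -> 0 <= delta ->
  (forall s : R, delta < s ->
    ~ contains_isometric_copy (injective_hull X) (cross_polytope n.+1 s)) ->
  hyperbolic X n (n%:R * delta).
Proof.
move=> n1 delta0 noX x; apply: contrapT => nhyp.
pose w i j := mdist (x i) (x j).
have nR0 : 0 < (2 * n)%:R :> R by rewrite ltr0n muln_gt0.
(* Failure for [n * delta] is a gap above [2 * n * delta] for every permutation other than [-id],
   hence a gap of at least [2 * n * s] for a common [s > delta]. *)
have [|s deltas gap] := gap_ratio R _ (fun alpha => alpha != index_opp_perm n)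
    (fun alpha : {perm signed_index n} =>
       \sum_i w i (index_opp i) - \sum_i w i (alpha i)) _ delta nR0.
  move=> alpha /eqP alpha_opp; rewrite ltNge; apply/negP => small.
  apply: nhyp; exists alpha => //.
  by move: small; rewrite natrM /w; lra.
have s0 : 0 <= s by lra.
have [||alpha alpha_opp|f [f_opp f_slack f_ge]] := slack_potential w s n1 s0.
- by move=> i j; exact: metric_sym.
- by move=> i j k; exact: metric_triangle.
- by have /gap : alpha != index_opp_perm n; [exact/eqP|lra].
exact: (noX s deltas (cross_polytope_copy_of_slack x f s s0 f_opp f_slack f_ge)).
Qed.

Theorem proposition4p3 (R : realType) (n : nat) (delta : R) (X : metricType R)
    (hn : (1 <= n)%N) (hdelta : 0 <= delta) :
  (hyperbolic X n delta ->
     forall s : R, delta < s ->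
       ~ contains_isometric_copy (injective_hull X) (cross_polytope n.+1 s))
  /\
  ((forall s : R, delta < s ->
       ~ contains_isometric_copy (injective_hull X) (cross_polytope n.+1 s)) ->
     hyperbolic X n (n%:R * delta)).
Proof.
split; first exact: hyperbolic_no_cross_polytope.
exact: no_cross_polytope_hyperbolic.
Qed.
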